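(* Let $\mathbb{K}$ be a field with $\operatorname{char}\mathbb{K}\neq 2$, let $n\ge 3$, and let $X=(x_{ij})$ be a $2\times n$ generic matrix over $\mathbb{K}$. Then $\operatorname{v}(P_2(X))=2$.
   Context: A generic $m\times n$ matrix over $\mathbb{K}$ is a matrix $X=(x_{ij})$ whose $mn$ entries are distinct algebraically independent indeterminates; we work in the standard graded polynomial ring $R=\mathbb{K}[x_{ij}\mid 1\le i\le m,\ 1\le j\le n]$. $P_2(X)\subseteq R$ denotes the $2\times 2$ permanental ideal of $X$: the ideal generated by all $2\times2$ subpermanents $x_{ik}x_{jl}+x_{il}x_{jk}$ with $1\le i<j\le m$, $1\le k<l\le n$. For a graded ideal $I$ of a standard graded polynomial ring $R=\bigoplus_{d\ge0}R_d$ over a field, the $\operatorname{v}$-number of $I$ is $$\operatorname{v}(I)=\min\{d\mid \text{there exist } f\in R_d \text{ and } \mathfrak{p}\in\operatorname{Ass}(I)\text{ such that } (I:f)=\mathfrak{p}\},$$ where $\operatorname{Ass}(I)$ is the set of associated primes of $R/I$ and $(I:f)=\{g\in R\mid gf\in I\}$. *)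

(* Defs.v *)
From mathcomp Require Import all_boot all_order all_algebra.
From mathcomp.multinomials Require Export mpoly.

Set Implicit Arguments.
Unset Strict Implicit.
Unset Printing Implicit Defensive.

Import GRing.Theory.
Local Open Scope ring_scope.

(* Subsets of a ring are Prop-valued, not {pred R}: the library's [idealr]
   requires decidable membership, which is not available for ideals given by
   generators. *)
Section Ideals.
Variable R : comNzRingType.
Implicit Types (I J P S : R -> Prop) (f g : R).

Definition eq_set I J : Prop := forall g, I g <-> J g.

Definition is_ideal I : Prop :=
  [/\ I 0,
      forall f g, I f -> I g -> I (f + g) &
      forall r f, I f -> I (r * f)].

Definition is_prime_ideal P : Prop :=
  [/\ is_ideal P,
      ~ P 1 &
      forall f g, P (f * g) -> P f \/ P g].

Definition ideal_gen S : R -> Prop := fun f =>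
  exists s : seq (R * R),
    (forall cg, cg \in s -> S cg.2) /\ f = \sum_(cg <- s) cg.1 * cg.2.

Definition colon I f : R -> Prop := fun g => I (g * f).

(* [colon I g] is the annihilator of the class of [g] in R/I. *)
Definition Ass I P : Prop :=
  is_prime_ideal P /\ exists g, eq_set P (colon I g).

End Ideals.

Section VNumber.
Variables (K : fieldType) (N : nat).
Implicit Types (I P : {mpoly K[N]} -> Prop) (d : nat).

Definition v_attained I d : Prop :=
  exists (f : {mpoly K[N]}) (P : {mpoly K[N]} -> Prop),
    [/\ f \is d.-homog, Ass I P & eq_set (colon I f) P].

(* The v-number as a relation, so that no value has to be chosen for ideals
   without associated primes; [is_v_number I d] says that the minimum exists
   and is [d]. *)
Definition is_v_number I d : Prop :=
  v_attained I d /\ forall d', v_attained I d' -> (d <= d')%N.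

End VNumber.

Section Permanental.
Variables (K : fieldType) (m n : nat).

(* The m * n variables are indexed by pairs through the bijection
   [mxvec_index]. *)
Definition generic_mx : 'M[{mpoly K[m * n]}]_(m, n) :=
  \matrix_(i < m, j < n) 'X_(mxvec_index i j).

End Permanental.

Definition perm2_ideal (R : comNzRingType) (m n : nat) (X : 'M[R]_(m, n)) :
    R -> Prop :=
  ideal_gen (fun f => exists (i j : 'I_m) (k l : 'I_n),
    [/\ (i < j)%N, (k < l)%N & f = X i k * X j l + X i l * X j k]).

(* Main.v *)
(* Write [a_j], [b_j] for the two rows of [X] and [I] for the permanental ideal.
   For columns [k <> l], the ideal generated by [a_k b_l + a_l b_k] and the
   variables outside these columns is the kernel of a toric map [segre k l] to
   [K[x, y, t]], hence prime, and it contains [I].  As [2] is a unit, [I]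
   contains [a_j b_j' b_j''] and [a_j a_j' b_j''] for distinct columns, so
   [(I : a_k b_l)] contains this prime; equality holds since
   [segre k l (a_k b_l) <> 0].  Thus the v-number is at most two.  Conversely,
   if [(I : f)] is prime, it contains [a_j a_k b_l], hence a variable [v] of some
   column [i].  Applying all the [segre i l] to [v f] gives [segre i l f = 0],
   which for [f] of degree at most one forces [f = 0]. *)
Require Import Defs.
From mathcomp Require Import all_boot all_order all_algebra.
From mathcomp Require Import ring zify.

Set Implicit Arguments.
Unset Strict Implicit.
Unset Printing Implicit Defensive.

Import GRing.Theory.
Local Open Scope ring_scope.

(** * Ideals, generators, colon ideals and prime kernels *)

Lemma idealN (R : comNzRingType) (I : R -> Prop) f :
  is_ideal I -> I f -> I (- f).
Proof. by move=> [_ _ IM] If; rewrite -mulN1r; apply: IM. Qed.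

Lemma idealB (R : comNzRingType) (I : R -> Prop) f g :
  is_ideal I -> I f -> I g -> I (f - g).
Proof. by move=> hI If Ig; have [_ ID _] := hI; apply: ID => //; apply: idealN. Qed.

Lemma ideal_sum (R : comNzRingType) (I : R -> Prop) (T : eqType) (s : seq T)
    (F : T -> R) :
  is_ideal I -> (forall t, t \in s -> I (F t)) -> I (\sum_(t <- s) F t).
Proof.
move=> [I0 ID _] IF; rewrite big_seq.
by elim/big_rec: _ => // t x ts Ix; apply: ID => //; apply: IF.
Qed.

Lemma ideal_subrXX (R : comNzRingType) (I : R -> Prop) x y d :
  is_ideal I -> I (x - y) -> I (x ^+ d - y ^+ d).
Proof. by move=> [_ _ IM] Ixy; rewrite subrXX mulrC; apply: IM. Qed.

Lemma ideal_gen_ideal (R : comNzRingType) (S : R -> Prop) :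
  is_ideal (ideal_gen S).
Proof.
split; first by exists [::]; rewrite big_nil.
- move=> _ _ [s [sS ->]] [t [tS ->]]; exists (s ++ t); rewrite big_cat.
  by split=> // cg; rewrite mem_cat => /orP[/sS|/tS].
- move=> r _ [s [sS ->]]; exists [seq (r * cg.1, cg.2) | cg <- s]; split.
    by move=> _ /mapP[cg /sS Scg ->].
  by rewrite big_map mulr_sumr; apply: eq_bigr => cg _; rewrite mulrA.
Qed.

Lemma mem_ideal_gen (R : comNzRingType) (S : R -> Prop) f :
  S f -> ideal_gen S f.
Proof.
move=> Sf; exists [:: (1, f)]; rewrite big_seq1 mul1r; split=> // cg.
by rewrite inE => /eqP->.
Qed.

Lemma ideal_gen_min (R : comNzRingType) (S I : R -> Prop) :
  is_ideal I -> (forall f, S f -> I f) -> forall f, ideal_gen S f -> I f.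
Proof.
move=> hI SI _ [s [sS ->]]; apply: ideal_sum => // cg /sS /SI Icg.
by have [_ _] := hI; apply.
Qed.

Lemma colon_ideal (R : comNzRingType) (I : R -> Prop) f :
  is_ideal I -> is_ideal (colon I f).
Proof.
rewrite /colon => -[I0 ID IM]; split; first by rewrite mul0r.
- by move=> g h Ig Ih; rewrite mulrDl; apply: ID.
- by move=> r g Ig; rewrite -mulrA; apply: (IM).
Qed.

Lemma ker_prime (R : comNzRingType) (D : idomainType) (phi : {rmorphism R -> D}) :
  is_prime_ideal (fun g => phi g = 0).
Proof.
split.
- split; first exact: rmorph0.
  + by move=> f g f0 g0; rewrite rmorphD f0 g0 addr0.
  + by move=> r f f0; rewrite rmorphM f0 mulr0.
- by rewrite rmorph1; apply/eqP/oner_neq0.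
- by move=> f g /eqP; rewrite rmorphM mulf_eq0 => /orP[/eqP|/eqP]; [left|right].
Qed.

(** * Permanental ideals of two-rowed matrices *)

Lemma perm2_is_ideal (R : comNzRingType) m n (X : 'M[R]_(m, n)) :
  is_ideal (perm2_ideal X).
Proof. exact: ideal_gen_ideal. Qed.

Lemma perm2_mem (R : comNzRingType) n (X : 'M[R]_(2, n)) k l :
  k != l -> perm2_ideal X (X 0 k * X 1 l + X 0 l * X 1 k).
Proof.
wlog lt_kl : k l / (k < l)%N => [wl | _].
  have [/wl //|lt_lk|/val_inj ->] := ltngtP k l; last by rewrite eqxx.
  by rewrite eq_sym addrC; apply: wl.
by apply: mem_ideal_gen; exists 0, 1, k, l.
Qed.

Lemma perm2_sub (R : comNzRingType) n (X : 'M[R]_(2, n)) I :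
  is_ideal I ->
  (forall k l, k != l -> I (X 0 k * X 1 l + X 0 l * X 1 k)) ->
  forall f, perm2_ideal X f -> I f.
Proof.
move=> hI IX; apply: ideal_gen_min => // _ [i [j [k [l [lt_ij lt_kl ->]]]]].
have -> : i = 0 by apply/val_inj; move: i j lt_ij => [[|[]]] // ? [[|[]]].
have -> : j = 1 by apply/val_inj; move: i j lt_ij => [[|[]]] // ? [[|[]]].
by apply: IX; apply: contraTneq lt_kl => ->; rewrite ltnn.
Qed.

(** Three monomials take one entry from each of the columns [j], [k], [l] with the same row content.
    Their pairwise sums are multiples of permanents, so twice each of them lies in the ideal. *)
Lemma perm2_col3 (R : comUnitRingType) n (X : 'M[R]_(2, n)) r j k l :
  2%:R \is a @GRing.unit R -> j != k -> j != l -> k != l ->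
  perm2_ideal X (X r j * (X 0 k * X 1 l)).
Proof.
move=> unit2 jk jl kl; have hI : is_ideal (perm2_ideal X) by apply: perm2_is_ideal.
have [_ ID IM] := hI; rewrite -[X r j * _](mulKr unit2); apply: (IM).
have Ijk := perm2_mem X jk; have Ijl := perm2_mem X jl; have Ikl := perm2_mem X kl.
have [->|->] : r = 0 \/ r = 1.
  by case: r => -[|[|//]] ?; [left|right]; apply: val_inj.
- have -> : 2%:R * (X 0 j * (X 0 k * X 1 l)) =
    X 0 j * (X 0 k * X 1 l + X 0 l * X 1 k) +
    (X 0 k * (X 0 j * X 1 l + X 0 l * X 1 j)
     - X 0 l * (X 0 j * X 1 k + X 0 k * X 1 j)) by ring.
  by apply: (ID); [|apply: idealB => //]; apply: (IM).
- have -> : 2%:R * (X 1 j * (X 0 k * X 1 l)) =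
    X 1 j * (X 0 k * X 1 l + X 0 l * X 1 k) -
    (X 1 k * (X 0 j * X 1 l + X 0 l * X 1 j)
     - X 1 l * (X 0 j * X 1 k + X 0 k * X 1 j)) by ring.
  by apply: idealB => //; [|apply: idealB => //]; apply: (IM).
Qed.

Lemma unit2_mpoly (K : fieldType) N :
  2%N \notin [pchar K] -> 2%:R \is a @GRing.unit {mpoly K[N]}.
Proof.
move=> char2; rewrite -(rmorph_nat (@mpolyC N K)); apply: rmorph_unit.
by rewrite unitfE; apply: contra char2 => ?; rewrite inE.
Qed.

(** * Linear relations between monomials and reduction modulo a binomial *)

(** Monomials form a basis, so [w] extends to a linear map, which respects the given relation.
    Concretely, terms with equal monomials are collected. *)
Lemma scale_mpolyX_sum0 (K : fieldType) N (V : lmodType K) (T : eqType)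
    (s : seq T) (c : T -> K) (mu : T -> 'X_{1..N}) (w : 'X_{1..N} -> V) :
  \sum_(t <- s) c t *: 'X_[mu t] = 0 :> {mpoly K[N]} ->
  \sum_(t <- s) c t *: w (mu t) = 0.
Proof.
move=> sum0; pose ms := undup [seq mu t | t <- s].
have wE t : t \in s -> w (mu t) = \sum_(m <- ms) (mu t == m)%:R *: w m.
  move=> ts; rewrite (bigD1_seq (mu t)) ?undup_uniq //=; last first.
    by rewrite mem_undup map_f.
  by rewrite eqxx scale1r big1 ?addr0 // => m; rewrite eq_sym => /negbTE->; rewrite scale0r.
rewrite (eq_big_seq (fun t => \sum_(m <- ms) (c t * (mu t == m)%:R) *: w m)); last first.
  by move=> t ts; rewrite {1}wE // scaler_sumr; apply: eq_bigr => m _; rewrite scalerA.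
rewrite exchange_big big1 //= => m _; rewrite -scaler_suml.
have /(congr1 (mcoeff m)) := sum0; rewrite mcoeff0 raddf_sum /= => E.
by rewrite -[RHS](scale0r (w m)) -[in RHS]E; congr (_ *: _); apply: eq_bigr => t _;
  rewrite mcoeffZ mcoeffX.
Qed.

(* Modulo [a d - b c], the monomial [a^i b^j c^k d^l] depends only on
   [i + k], [j + l] and [k + l]; the second monomial is the representative
   with the largest exponents of [b] and [c]. *)
Lemma segre_monomial_mod (R : comNzRingType) (J : R -> Prop) a b c d i j k l :
  is_ideal J -> J (a * d - b * c) ->
  let k' := minn (i + k) (k + l) in let l' := (k + l - k')%N in
  J (a ^+ i * b ^+ j * c ^+ k * d ^+ l -
     a ^+ (i + k - k') * b ^+ (j + l - l') * c ^+ k' * d ^+ l').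
Proof.
(* [e] is the number of factors [a * d] that can be traded for [b * c]. *)
move=> hJ Jadbc k' l'; pose e := minn i l.
have [-> -> -> Ei El] : [/\ (i + k - k' = i - e)%N, (j + l - l' = j + e)%N,
    k' = (k + e)%N, i = (i - e + e)%N & l = (l - e + e)%N].
  by rewrite /l' /k' /e; split; lia.
have -> : l' = (l - e)%N by rewrite /l' /k' /e; lia.
rewrite {1}Ei {1}El !exprD.
set x := a ^+ (i - e); set y := d ^+ (l - e).
have -> : x * a ^+ e * b ^+ j * c ^+ k * (y * d ^+ e)
    - x * (b ^+ j * b ^+ e) * (c ^+ k * c ^+ e) * y
  = x * b ^+ j * c ^+ k * y * ((a * d) ^+ e - (b * c) ^+ e).
  by rewrite !exprMn; ring.
by have [_ _] := hJ; apply; apply: ideal_subrXX.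
Qed.

(** * The toric maps *)

(* Columns [k] and [l] are [(x, t x)] and [(y, - t y)], with [x], [y], [t] the
   variables ['X_0], ['X_1], ['X_2]; the other columns vanish. *)
Definition segre_mx (K : fieldType) n (k l : 'I_n) : 'M[{mpoly K[3]}]_(2, n) :=
  \matrix_(r, j) (('X_2%:R ^+ r * 'X_0) *+ (j == k)
                  + ((- 'X_2%:R) ^+ r * 'X_1) *+ (j == l)).

Definition segre (K : fieldType) n (k l : 'I_n) :
    {rmorphism {mpoly K[2 * n]} -> {mpoly K[3]}} :=
  mmap (@mpolyC 3 K) (fun i => mxvec (segre_mx K k l) 0 i).

Lemma segreX (K : fieldType) n (k l : 'I_n) r j :
  segre K k l (generic_mx K 2 n r j) = segre_mx K k l r j.
Proof. by rewrite mxE /segre /= mmapX mmap1U mxvecE. Qed.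

(** The columns [k] and [l] have permanent [x (- t y) + y (t x) = 0]; every other pair of columns
    contains a zero column. *)
Lemma segre_perm2 (K : fieldType) n (k l : 'I_n) f :
  k != l -> perm2_ideal (generic_mx K 2 n) f -> segre K k l f = 0.
Proof.
move=> kl; have [kerI _ _] := ker_prime (segre K k l).
apply: (perm2_sub kerI) => i j ij.
rewrite rmorphD !rmorphM !segreX !mxE /= !expr0 !expr1.
have [ik|ik] := eqVneq i k; have [jk|jk] := eqVneq j k;
have [il|il] := eqVneq i l; have [jl|jl] := eqVneq j l; subst;
  rewrite ?eqxx ?mulr0n ?mulr1n // in kl ij *; ring.
Qed.

Lemma segre_mxE (K : fieldType) n (k l : 'I_n) r :
  k != l ->
  segre_mx K k l r k = 'X_2%:R ^+ r * 'X_0 /\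
  segre_mx K k l r l = (- 'X_2%:R) ^+ r * 'X_1.
Proof.
move=> kl; rewrite !mxE !eqxx [l == k]eq_sym (negbTE kl).
by rewrite !mulr1n !mulr0n addr0 add0r.
Qed.

Lemma mpolyX3 (K : fieldType) (m : 'X_{1..3}) :
  'X_[m] = 'X_0 ^+ m 0 * 'X_1 ^+ m 1 * 'X_2%:R ^+ m 2%:R :> {mpoly K[3]}.
Proof.
rewrite mpolyXE_id !big_ord_recl big_ord0 mulr1 mulrA.
have -> : lift ord0 (lift ord0 ord0) = 2%:R :> 'I_3 by apply: val_inj.
by have -> : lift ord0 ord0 = 1 :> 'I_3 by apply: val_inj.
Qed.

(** * Monomials supported in two columns *)

Lemma big_cols2 (T : Type) (idx : T) (op : Monoid.com_law idx) n (k l : 'I_n)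
    (F : 'I_(2 * n) -> T) :
  k != l -> (forall r j, j != k -> j != l -> F (mxvec_index r j) = idx) ->
  \big[op/idx]_i F i =
    op (op (F (mxvec_index 0 k)) (F (mxvec_index 1 k)))
       (op (F (mxvec_index 0 l)) (F (mxvec_index 1 l))).
Proof.
move=> kl F0; rewrite (reindex _ (curry_mxvec_bij 2 n)) /=.
pose G r j := F (mxvec_index r j).
rewrite (eq_bigr (fun p => G p.1 p.2)) => [|[r j] _] //.
rewrite -(pair_bigA _ G) /= exchange_big /=.
have lk : l != k by rewrite eq_sym.
rewrite (bigD1 k) //= (bigD1 l) //= [X in op _ (op _ X)]big1 => [|j /andP[jk jl]].
  rewrite Monoid.mulm1 !big_ord_recl !big_ord0 !Monoid.mulm1 /G.
  by have -> : lift ord0 ord0 = 1 :> 'I_2 by apply: val_inj.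
by rewrite big1 // => r _; apply: F0.
Qed.

Definition in_cols n (k l : 'I_n) (m : 'X_{1..2 * n}) : bool :=
  [forall r : 'I_2, forall j : 'I_n,
    [|| j == k, j == l | m (mxvec_index r j) == 0%N]].

Lemma in_colsP n (k l : 'I_n) (m : 'X_{1..2 * n}) :
  reflect (forall r j, j != k -> j != l -> m (mxvec_index r j) = 0%N)
    (in_cols k l m).
Proof.
apply: (iffP forallP) => [m0 r j jk jl | m0 r].
  by have /forallP/(_ j) := m0 r; rewrite (negbTE jk) (negbTE jl) => /eqP.
apply/forallP => j; have [//|jk] := eqVneq j k; have [//|jl] := eqVneq j l.
by rewrite m0.
Qed.

Lemma not_in_cols (K : fieldType) n (k l : 'I_n) (m : 'X_{1..2 * n}) :
  ~~ in_cols k l m -> exists r j, [/\ j != k, j != l &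
    'X_[m] = 'X_[m - U_(mxvec_index r j)] * generic_mx K 2 n r j].
Proof.
case/forallPn=> r /forallPn[j]; rewrite !negb_or => /and3P[jk jl mrj].
by exists r, j; split=> //; rewrite mxE -mpolyXD submK // lep1mP.
Qed.

Lemma mmap1_cols2 (S : comNzRingType) n (A : 'M[S]_(2, n)) (k l : 'I_n)
    (m : 'X_{1..2 * n}) :
  k != l -> in_cols k l m ->
  mmap1 (fun i => mxvec A 0 i) m =
    A 0 k ^+ m (mxvec_index 0 k) * A 0 l ^+ m (mxvec_index 0 l) *
    A 1 k ^+ m (mxvec_index 1 k) * A 1 l ^+ m (mxvec_index 1 l).
Proof.
move=> kl /in_colsP m0; rewrite /mmap1 (big_cols2 _ kl) => [|r j jk jl].
  by rewrite /= !mxvecE; ring.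
by rewrite m0.
Qed.

Lemma mdeg_cols2 n (k l : 'I_n) (m : 'X_{1..2 * n}) :
  k != l -> in_cols k l m ->
  mdeg m = (m (mxvec_index 0%R k) + m (mxvec_index 1%R k) +
            (m (mxvec_index 0%R l) + m (mxvec_index 1%R l)))%N.
Proof. by move=> kl /in_colsP m0; rewrite mdegE (big_cols2 _ kl). Qed.

(** * The toric map on monomials and its kernel *)

Lemma mpolyX_generic (K : fieldType) n (m : 'X_{1..2 * n}) :
  'X_[m] = mmap1 (fun i => mxvec (generic_mx K 2 n) 0 i) m.
Proof.
rewrite -mmap1_id; apply: mmap1_eq => i.
by case/mxvec_indexP: i => r j; rewrite mxvecE mxE.
Qed.

(** The degrees in column [k], in column [l] and in the second row are the exponents of [x], [y] and
    [t]. *)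
Definition segre_exp n (k l : 'I_n) (m : 'X_{1..2 * n}) : 'X_{1..3} :=
  let e r j := m (mxvec_index r j) in
  let a := e 0 k in let b := e 0 l in let c := e 1 k in let d := e 1 l in
  [multinom (nth 0%N [:: a + c; b + d; c + d]%N i) | i < 3].

Definition segre_coef (K : fieldType) n (k l : 'I_n) (m : 'X_{1..2 * n}) : K :=
  if in_cols k l m then (-1) ^+ m (mxvec_index 1 l) else 0.

Lemma segre_monomial (K : fieldType) n (k l : 'I_n) m :
  k != l -> segre K k l 'X_[m] = segre_coef K k l m *: 'X_[segre_exp k l m].
Proof.
move=> kl; rewrite /segre_coef; case: ifPn => [m_kl | /(not_in_cols K)]; last first.
  case=> [r [j [/negbTE jk /negbTE jl ->]]].
  by rewrite scale0r rmorphM segreX mxE jk jl !mulr0n addr0 mulr0.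
rewrite /segre /= mmapX (mmap1_cols2 _ kl) //.
have [-> ->] := segre_mxE K 0 kl; have [-> ->] := segre_mxE K 1 kl.
rewrite [in RHS]mpolyX3 !mnmE /= -mul_mpolyC rmorphXn rmorphN rmorph1 /=.
by rewrite !expr0 !expr1 !mul1r mulNr exprNn !exprMn !exprD; ring.
Qed.

(** In the relation [segre K k l f = 0], arbitrary vectors may replace the target monomials: normal
    forms modulo the colon ideal, or indicators that extract a coefficient. *)
Lemma segre_ker_sum0 (K : fieldType) n (k l : 'I_n) (V : lmodType K)
    (w : 'X_{1..3} -> V) f :
  k != l -> segre K k l f = 0 ->
  \sum_(m <- msupp f) (f@_m * segre_coef K k l m) *: w (segre_exp k l m) = 0.
Proof.
move=> kl fE; apply: scale_mpolyX_sum0.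
rewrite -[RHS]fE [in RHS](mpolyE f) rmorph_sum; apply: eq_bigr => m _ /=.
by rewrite /segre /= mmapZ -/(segre K k l) mul_mpolyC -scalerA -segre_monomial.
Qed.

(** Modulo the colon ideal, each monomial is a scalar multiple of a normal form that depends only on
    its image. The normal forms of the terms of [f] cancel because their images do. *)
Lemma segre_ker_colon (K : fieldType) n (k l : 'I_n) f :
  2%N \notin [pchar K] -> k != l -> let X := generic_mx K 2 n in
  segre K k l f = 0 -> colon (perm2_ideal X) (X 0 k * X 1 l) f.
Proof.
move=> char2 kl X fE; set J := colon _ _.
have hI : is_ideal (perm2_ideal X) by apply: perm2_is_ideal.
have hJ : is_ideal J by apply: colon_ideal.
have [_ _ JM] := hJ; have [_ _ IM] := hI.
have JX r j : j != k -> j != l -> J (X r j).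
  by move=> jk jl; apply: perm2_col3 => //; apply: unit2_mpoly.
(* Replacing [X 1 l] by its opposite turns the permanent into a binomial [a d - b c]. *)
have JP : J (X 0 k * - X 1 l - X 0 l * X 1 k).
  rewrite (_ : _ - _ = -1 * (X 0 k * X 1 l + X 0 l * X 1 k)); last by ring.
  by apply: (JM); rewrite /J /colon mulrC; apply: IM; apply: perm2_mem.
(* [w] rebuilds the representative of [segre_monomial_mod] from the column and row degrees. *)
pose w (m : 'X_{1..3}) := let k' := minn (m 0) (m 2%:R) in
  let l' := (m 2%:R - k')%N in
  X 0 k ^+ (m 0 - k') * X 0 l ^+ (m 1 - l') * X 1 k ^+ k' * (- X 1 l) ^+ l'.
have JE m : J ('X_[m] - segre_coef K k l m *: w (segre_exp k l m)).
  rewrite /segre_coef; case: ifPn => [m_kl | /(not_in_cols K)[r [j [jk jl ->]]]].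
    rewrite mpolyX_generic (mmap1_cols2 _ kl) // -/X /w !mnmE /=.
    rewrite -mul_mpolyC rmorphXn rmorphN rmorph1 /=.
    rewrite -[X 1 l in X in X - _]opprK exprNn mulrCA -mulrBr; apply: JM.
    exact: (segre_monomial_mod _ _ _ _ hJ JP).
  by rewrite scale0r subr0; apply: JM; apply: JX.
have -> : f = \sum_(m <- msupp f)
    f@_m *: ('X_[m] - segre_coef K k l m *: w (segre_exp k l m)).
  rewrite {1}[f]mpolyE; under [RHS]eq_bigr => m _ do rewrite scalerBr scalerA.
  by rewrite sumrB segre_ker_sum0 ?subr0.
by apply: ideal_sum => // m _; rewrite -mul_mpolyC; apply: JM.
Qed.

(** In degree at most one, row and column degrees determine the monomial; in degree two, [a_k b_l]
    and [a_l b_k] already collide. *)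
Lemma segre_exp_inj n (k l : 'I_n) m m' :
  k != l -> in_cols k l m -> in_cols k l m' ->
  mdeg m = mdeg m' -> (mdeg m <= 1)%N ->
  segre_exp k l m = segre_exp k l m' -> m = m'.
Proof.
move=> kl hm hm'; rewrite !(mdeg_cols2 kl) // => dE d1 E.
have E0 := congr1 (fun e : 'X_{1..3} => e 0) E.
have E1 := congr1 (fun e : 'X_{1..3} => e 1) E.
have E2 := congr1 (fun e : 'X_{1..3} => e 2%:R) E.
rewrite !mnmE /= in E0 E1 E2; apply/mnmP => i.
case/mxvec_indexP: i => r j.
have [->|->] : r = 0 \/ r = 1.
    by case: r => -[|[|//]] ?; [left|right]; apply: val_inj.
all: have [->|jk] := eqVneq j k; first lia.
all: have [->|jl] := eqVneq j l; first lia.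
all: by rewrite (in_colsP _ _ _ hm) // (in_colsP _ _ _ hm').
Qed.

Lemma segre_ker_mcoeff (K : fieldType) n (k l : 'I_n) f d m :
  (d <= 1)%N -> f \is d.-homog -> k != l -> segre K k l f = 0 ->
  in_cols k l m -> f@_m = 0.
Proof.
move=> d1 fd kl fE m_kl; apply/eqP; apply/negPn/negP => fm.
(* With this indicator, only [m] itself contributes to the sum, up to sign. *)
pose w e : K^o := (e == segre_exp k l m)%:R.
have := segre_ker_sum0 w kl fE.
have m_f : m \in msupp f by rewrite mcoeff_msupp.
rewrite (bigD1_seq m) ?msupp_uniq //= /w eqxx big_seq_cond big1 => [|m' /andP[m'_f m'm]].
  rewrite addr0 /segre_coef m_kl => /eqP; rewrite /GRing.scale /= mulr1.
  by rewrite mulf_eq0 (negbTE fm) signr_eq0.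
rewrite /segre_coef; case: ifPn => m'_kl; last by rewrite mulr0 scale0r.
case: eqP => [E|_]; last by rewrite scaler0.
move/dhomogP: fd => fd; case/eqP: m'm.
by apply: segre_exp_inj E => //; rewrite ?fd.
Qed.

(* The kernels of the maps [segre i l], [l != i], all avoid the variable
   [x_(r i)], and their intersection has no nonzero forms of degree at most one. *)
Lemma low_degree_perm2_mul (K : fieldType) n (f : {mpoly K[2 * n]}) d r i :
  (1 < n)%N -> (d <= 1)%N -> f \is d.-homog ->
  perm2_ideal (generic_mx K 2 n) (generic_mx K 2 n r i * f) -> f = 0.
Proof.
move=> n1 d1 fd If.
have fl l : i != l -> segre K i l f = 0.
  (* The variable in column [i] maps to [x] or [t x], which cancels in a domain. *)
  move=> il; have := segre_perm2 il If; rewrite rmorphM segreX => /eqP.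
  have [-> _] := segre_mxE K r il; rewrite mulf_eq0 => /orP[|/eqP //].
  by rewrite mulf_eq0 expf_eq0 => /orP[/andP[_]|]; rewrite -msupp_eq0 msuppX.
apply/mpolyP => m; rewrite mcoeff0.
have [m_f|] := boolP (m \in msupp f); last by move/memN_msupp_eq0.
have md : mdeg m = d by move/dhomogP: fd => ->.
suff [l il m_il] : exists2 l, i != l & in_cols i l m.
  exact: (segre_ker_mcoeff d1 fd il (fl l il) m_il).
(* Any second column serves for constants and for variables of column [i]; the cyclic successor
   [i + 1] is one. *)
have [l0 il0] : exists l, i != l.
  case: n n1 i {f fd If fl m m_f md} => [|[|n]] // _ i; exists (i + 1).
  by rewrite eq_sym -subr_eq0 addrAC subrr add0r oner_neq0.
case: d d1 md {fd} => [|[|//]] _ /eqP.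
  rewrite mdeg_eq0 => /eqP ->; exists l0 => //; apply/in_colsP => r' j _ _.
  by rewrite mnm0E.
case/mdeg1P => v /eqP ->; case/mxvec_indexP: v => r' j.
suff [l il j_il] : exists2 l, i != l & (j == i) || (j == l).
  exists l => //; apply/in_colsP => r'' j' j'i j'l; rewrite mnm1E.
  case: eqP => [/cast_ord_inj/enum_rank_inj[_ E]|//].
  by move: j_il; rewrite E (negbTE j'i) (negbTE j'l).
have [->|ji] := eqVneq j i; first by exists l0.
by exists j; rewrite ?eqxx // eq_sym.
Qed.

Theorem theorem3p1 (K : fieldType) (n : nat)
    (charK : 2%N \notin [pchar K]%R) (n_ge3 : (3 <= n)%N) :
  is_v_number (perm2_ideal (generic_mx K 2 n)) 2.
Proof.
have n0 : (0 < n)%N by apply: ltn_trans n_ge3.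
have n1 : (1 < n)%N by apply: ltn_trans n_ge3.
(* Columns [k] and [l] carry the quadric attaining the value; [j] is the third column for the lower
   bound. *)
pose k := Ordinal n0; pose l := Ordinal n1; pose j := Ordinal n_ge3.
set X := generic_mx K 2 n; set I := perm2_ideal X.
have [I0 _ IM] : is_ideal I by apply: perm2_is_ideal.
split.
  have kl : k != l by [].
  have colonE : eq_set (colon I (X 0 k * X 1 l)) (fun g => segre K k l g = 0).
    move=> g; split=> [/(segre_perm2 kl) /eqP|]; last exact: segre_ker_colon.
    (* The image of [a_k b_l] is [- t x y], which is nonzero and cancels. *)
    rewrite rmorphM mulf_eq0 => /orP[/eqP // | ].
    rewrite rmorphM !segreX; have [-> _] := segre_mxE K 0 kl.
    have [_ ->] := segre_mxE K 1 kl.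
    by rewrite expr0 expr1 mul1r !mulf_eq0 oppr_eq0 -!msupp_eq0 !msuppX.
  exists (X 0 k * X 1 l), (fun g => segre K k l g = 0); split=> //.
    by rewrite !mxE; apply: (@dhomogM _ _ _ 1 _ 1); rewrite dhomogX /= mdeg1.
  split; first exact: ker_prime.
  by exists (X 0 k * X 1 l) => g; split=> /colonE.
move=> d [f [P [fd [[_ P1 PM] _] fP]]]; rewrite leqNgt; apply/negP => d1.
have unit2 := @unit2_mpoly K (2 * n) charK.
have /fP /PM : colon I f (X 0 j * (X 0 k * X 1 l)).
  by rewrite /colon mulrC; apply: IM; apply: perm2_col3.
(* A variable in [P] would force [f = 0], and then [1] would lie in [P]. *)
have f0 r i : ~ P (X r i).
  move/fP => /(low_degree_perm2_mul n1 d1 fd) fE; apply: P1; apply/fP.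
  by rewrite /colon fE mulr0.
by move=> [/f0|/PM[/f0|/f0]].
Qed.
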